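(* Let $f$ be a continuous self-similar function on $[0,1]$ with self-similarity parameters $\{a_k\},\{c_k\},\{d_k\},\{\beta_k\}$, $k=1,\dots,n$, such that $f(0)=0$, $f(1)=1$ and $c_k=0$ for $k=1,\dots,n$. Put $D=\sum_{k=1}^n|d_k|$. Then $f$ has bounded variation on $[0,1]$ if and only if $D\le1$.
   Context: Let $n>1$ be an integer, $a_k>0$ and $c_k,d_k,\beta_k\in\mathbb R$ ($k=1,\dots,n$) with $\sum_{k=1}^n a_k=1$. Set $\alpha_1=0$ and $\alpha_k=\sum_{l=1}^{k-1}a_l$ for $k=2,\dots,n+1$. The similarity operator $G$ with these parameters acts on functions on $[0,1]$ by $$G(f)(x)=c_k\,t+d_k\,f(t)+\beta_k,\qquad x=a_kt+\alpha_k\in(\alpha_k,\alpha_{k+1}),\quad t\in(0,1),\quad k=1,\dots,n.$$ A continuous self-similar function $f$ with these parameters is a continuous function with $G(f)=f$ (so for continuous $f$, $f(a_kt+\alpha_k)=c_kt+d_kf(t)+\beta_k$ for all $t\in[0,1]$ and all $k$), where $\max_{1\le k\le n}|d_k|<1$. When $f(0)=0$, $f(1)=1$ and all $c_k=0$, the parameters satisfy $\beta_1=0$, $\beta_{k+1}-\beta_k=d_k$ for $k=1,\dots,n-1$, and $\sum_{k=1}^n d_k=1$ (hence $D\ge1$). *)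

(* Defs.v *)
From HB Require Import structures.
From mathcomp Require Import all_boot all_order all_algebra.
From mathcomp Require Import all_classical all_reals all_analysis.
From mathcomp Require Import ring lra.
Set Implicit Arguments.
Unset Strict Implicit.
Unset Printing Implicit Defensive.
Import Order.TTheory GRing.Theory Num.Theory.
Import numFieldNormedType.Exports.
Local Open Scope classical_set_scope.
Local Open Scope ring_scope.

(* With indices 0, ..., n-1, [breakpoint a k] is alpha_{k+1} (alpha_1 = 0),
   so the cell of index k is ]breakpoint a k, breakpoint a k.+1[. *)
Definition breakpoint (R : realType) (n : nat) (a : 'I_n -> R) (k : nat) : R :=
  \sum_(l < n | (l < k)%N) a l.

(* The cells are pairwise disjoint when all a_k > 0, so the sum has at most one
   term. At the breakpoints, where the operator is not specified, the value is
   the junk value 0. *)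
Definition similarity_operator (R : realType) (n : nat)
    (a c d beta : 'I_n -> R) (f : R -> R) (x : R) : R :=
  \sum_(k < n | breakpoint a k < x < breakpoint a k.+1)
    (let t := (x - breakpoint a k) / a k in c k * t + d k * f t + beta k).

(* The fixed-point equation G(f) = f is required on the open cells only, where
   G(f) is specified; f matters only through its restriction to [0, 1]. *)
Definition continuous_self_similar (R : realType) (n : nat)
    (a c d beta : 'I_n -> R) (f : R -> R) : Prop :=
  [/\ \big[Num.max/0]_(k < n) `|d k| < 1,
      {within `[0, 1], continuous f} &
      forall (k : 'I_n) (x : R), breakpoint a k < x < breakpoint a k.+1 ->
        similarity_operator a c d beta f x = f x].

Lemma breakpointS (R : realType) (n : nat) (a : 'I_n -> R) (k : 'I_n) :
  breakpoint a k.+1 = breakpoint a k + a k.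
Proof.
rewrite /breakpoint (bigD1 k) ?ltnSn //= addrC; congr (_ + _).
by apply: eq_bigl => l; rewrite ltnS [RHS]ltn_neqAle andbC.
Qed.

Lemma breakpoint_le (R : realType) (n : nat) (a : 'I_n -> R) (i j : nat) :
  (forall k, 0 < a k) -> (i <= j)%N -> breakpoint a i <= breakpoint a j.
Proof.
move=> a0 ij; rewrite /breakpoint big_mkcond [leRHS]big_mkcond /=.
apply: ler_sum => l _; case: ifPn => [l_i|_].
  by rewrite (leq_trans l_i ij).
by case: ifP => // _; exact: ltW.
Qed.

Lemma similarity_operatorE (R : realType) (n : nat)
    (a c d beta : 'I_n -> R) (f : R -> R) (k : 'I_n) (t : R) :
  (forall l, 0 < a l) -> 0 < t < 1 ->
  similarity_operator a c d beta f (a k * t + breakpoint a k) =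
  c k * t + d k * f t + beta k.
Proof.
move=> a0 /andP[t0 t1]; set x := _ + _.
have xk : breakpoint a k < x < breakpoint a k.+1.
  have := a0 k; rewrite breakpointS /x => ak.
  by apply/andP; split; nra.
rewrite /similarity_operator (bigD1 k) //= big1 => [|l /andP[/andP[lx xl] lk]].
  by rewrite addr0 /x addrK mulrAC divff ?mul1r // gt_eqF.
move/andP: xk => [kx xk]; exfalso.
case: (ltngtP l k) => [l_k|k_l|/val_inj e]; last by rewrite e eqxx in lk.
- by have := breakpoint_le a0 l_k; lra.
- by have := breakpoint_le a0 k_l; lra.
Qed.

(* Main.v *)
Require Import Defs.
From HB Require Import structures.
From mathcomp Require Import all_boot all_order all_algebra.
From mathcomp Require Import all_classical all_reals all_analysis.
From mathcomp Require Import ring lra.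
Set Implicit Arguments.
Unset Strict Implicit.
Unset Printing Implicit Defensive.
Import Order.TTheory GRing.Theory Num.Theory.
Import numFieldNormedType.Exports.
Local Open Scope classical_set_scope.
Local Open Scope ring_scope.

(** If [f] has bounded variation, then its total variation [V] satisfies
    [V >= D V], the variation over the cell of index [k] being [`|d k|] times
    [V], and [V >= f 1 - f 0 = 1]; hence [D <= 1].  Conversely the [d k] sum
    to [1], so [D <= 1] forces them to be nonnegative.  Then [0 <= f <= 1], the
    values at the breakpoints increase, and the supremum [m >= 0] of
    [f s - f t] over [s <= t] satisfies [m <= (\max_k `|d k|) m], so that
    [m = 0] and [f] is nondecreasing. *)

(** * Continuity on closed intervals *)

Lemma within_continuous_eq_itv (R : realType) (a b : R) (f g : R -> R) :
  a < b -> {within `[a, b], continuous f} -> {within `[a, b], continuous g} ->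
  {in `]a, b[, f =1 g} -> {in `[a, b], f =1 g}.
Proof.
move=> ab /(continuous_within_itvP _ ab)[_ fa fb].
move=> /(continuous_within_itvP _ ab)[_ ga gb] fg x.
rewrite in_itv /= !le_eqVlt => /andP[/predU1P[<- _|ax]].
  apply: (@cvg_unique _ (@norm_hausdorff _ _) (f @ a^'+)) => //.
  apply: cvg_trans ga; apply: near_eq_cvg; near=> y.
  by apply/esym/fg; rewrite in_itv /=; apply/andP; split; near: y;
    [exact: nbhs_right_gt|exact: nbhs_right_lt].
move=> /predU1P[->|xb]; last by apply: fg; rewrite in_itv /= ax.
apply: (@cvg_unique _ (@norm_hausdorff _ _) (f @ b^'-)) => //.
apply: cvg_trans gb; apply: near_eq_cvg; near=> y.
by apply/esym/fg; rewrite in_itv /=; apply/andP; split; near: y;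
  [exact: nbhs_left_gt|exact: nbhs_left_lt].
Unshelve. all: by end_near. Qed.

Lemma within_continuous_comp_within (T U W : topologicalType) (A : set T)
    (B : set U) (f : U -> W) (g : T -> U) :
  continuous g -> (forall x, A x -> B (g x)) ->
  {within B, continuous f} -> {within A, continuous (f \o g)}.
Proof.
move=> cg AB /subspace_continuousP cf; apply/subspace_continuousP => x Ax.
have gB : g @ within A (nbhs x) --> within B (nbhs (g x)).
  move=> V /(cg x) gV; suff : \forall t \near x, A t -> V (g t) by [].
  apply: (@filterS _ (nbhs x) (nbhs_filter x) _ _ _ gV) => t /= BV /AB; exact: BV.
exact: cvg_comp gB (cf _ (AB _ Ax)).
Qed.

(** * Variation under affine changes of variable *)

Lemma itv_partition_affine (R : realType) (p q a b : R) (s : seq R) :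
  0 < p -> itv_partition a b s ->
  itv_partition (p * a + q) (p * b + q) [seq p * t + q | t <- s].
Proof.
move=> p0 [sa /eqP <-]; split.
  apply: (homo_path (f := fun t => p * t + q)) sa => x y xy /=.
  by rewrite ltrD2r ltr_pM2l.
by rewrite (last_map (fun t => p * t + q)).
Qed.

Lemma variation_affine (R : realType) (p q d e a b : R) (f h : R -> R)
    (s : seq R) :
  {in `[a, b], forall t, f (p * t + q) = d * h t + e} -> itv_partition a b s ->
  variation (p * a + q) (p * b + q) f [seq p * t + q | t <- s] =
  `|d| * variation a b h s.
Proof.
move=> fh abs; rewrite /variation size_map mulr_sumr !big_nat.
apply: eq_bigr => i /andP[_ si].
have inab j : (j < (size s).+1)%N -> nth b (a :: s) j \in `[a, b].
  by move=> js; rewrite in_itv /= itv_partition_nth_ge ?itv_partition_nth_le.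
rewrite /= -(map_cons (fun t => p * t + q)) !(nth_map b) ?fh ?inab //=.
- by rewrite -normrM; congr `|_|; ring.
- exact: leqW.
- exact: inab i.+1 si.
- exact: leqW.
Qed.

(** An increasing affine map carries partitions to partitions, and each increment of [f] along the
    image is [d] times that of [h], since [e] cancels. *)
Lemma total_variation_affine_ge (R : realType) (p q d e a b : R) (f h : R -> R) :
  0 < p -> a <= b ->
  {in `[a, b], forall t, f (p * t + q) = d * h t + e} ->
  (`|d|%:E * total_variation a b h <=
   total_variation (p * a + q) (p * b + q) f)%E.
Proof.
(* For [d = 0] the left side is 0 even when the total variation of [h] is infinite. Otherwise
   division by [|d|] turns the claim into a bound on a supremum. *)
move=> p0 ab fh; have [->|d0] := eqVneq d 0.
  by rewrite normr0 mul0e total_variation_ge0 // lerD2r ler_pM2l.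
have nd0 : 0 < `|d| by rewrite normr_gt0.
rewrite -lee_pdivlMl //; apply: ge_ereal_sup => _ [_ [s abs <-] <-].
rewrite lee_pdivlMl // -EFinM -(variation_affine fh abs).
apply: ereal_sup_ubound; exists (variation (p * a + q) (p * b + q) f
  [seq p * t + q | t <- s]) => //.
by apply: variations_variation; exact: itv_partition_affine.
Qed.

(** * Covering by the closed cells *)

Section breakpoints.
Variables (R : realType) (n : nat) (a : 'I_n -> R).
Hypothesis a_gt0 : forall k, 0 < a k.

Lemma breakpoint0 : breakpoint a 0 = 0.
Proof. by rewrite /breakpoint big_pred0. Qed.

Lemma breakpoint_size : breakpoint a n = \sum_(k < n) a k.
Proof. by apply: eq_bigl => k; rewrite ltn_ord. Qed.

Lemma breakpoint_cell (x : R) :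
  (0 < n)%N -> 0 <= x <= \sum_(k < n) a k ->
  exists k, exists2 t, t \in `[0, 1] & x = a k * t + breakpoint a k.
Proof.
move=> n0 /andP[x0]; rewrite -breakpoint_size => xn.
(* Induction on [m] finds the first cell whose right end is at least [x]; it is used with
   [m = n.-1], whose right end is the whole sum. *)
have H m : (m < n)%N -> x <= breakpoint a m.+1 ->
    exists k : 'I_n, breakpoint a k <= x <= breakpoint a k.+1.
  elim: m => [n1 x1|m IH mn xm].
    by exists (Ordinal n1); rewrite /= breakpoint0 x0.
  have [/IH|mx] := leP x (breakpoint a m.+1); first by apply; exact: ltnW.
  by exists (Ordinal mn); rewrite /= (ltW mx).
have [||k /andP[kx xk]] := H n.-1; rewrite ?prednK //.
exists k, ((x - breakpoint a k) / a k).
  rewrite in_itv /= divr_ge0 ?subr_ge0 ?(ltW (a_gt0 k)) //=.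
  by rewrite ler_pdivrMr // mul1r lerBlDl -breakpointS.
by rewrite mulrC divfK ?subrK // gt_eqF.
Qed.

End breakpoints.

(** * The functional equation on closed cells *)

Section self_similar.
Variables (R : realType) (n : nat) (a c d beta : 'I_n -> R) (f : R -> R).
Hypothesis a_gt0 : forall k, 0 < a k.
Hypothesis a_sum : \sum_(k < n) a k = 1.
Hypothesis fss : continuous_self_similar a c d beta f.

Lemma breakpoint_itv (k : nat) : breakpoint a k \in `[0, 1].
Proof.
rewrite in_itv /= -{1}(breakpoint0 a) breakpoint_le //= -a_sum.
rewrite /breakpoint big_mkcond /=.
by apply: ler_sum => l _; case: ifP => // _; exact: ltW.
Qed.

(** The fixed-point equation gives this for [t] in the open interval only; both sides are continuous
    on [[0, 1]], so it extends to the endpoints. *)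
Lemma self_similar_segment (k : 'I_n) :
  {in `[0, 1], forall t,
    f (a k * t + breakpoint a k) = c k * t + d k * f t + beta k}.
Proof.
have [_ cf fG] := fss.
pose g (t : R) := a k * t + breakpoint a k.
have cg : continuous g.
  by move=> x; apply: cvgD; [apply: cvgMl_tmp; exact: cvg_id|exact: cvg_cst].
have g01 (x : R) : x \in `[0, 1] -> g x \in `[0, 1].
  rewrite !in_itv /= => /andP[x0 x1].
  have := breakpoint_itv k; have := breakpoint_itv k.+1.
  rewrite breakpointS !in_itv /= => /andP[_ ?] /andP[? _].
  have := a_gt0 k; rewrite /g => ak; apply/andP; split; nra.
apply: within_continuous_eq_itv => //.
- exact: within_continuous_comp_within cg g01 cf.
- move=> x; apply: cvgD; last exact: cvg_cst.
  apply: cvgD; last by apply: cvgMl_tmp; exact: cf.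
  have cc : continuous (fun t : R => c k * t).
    by move=> y; apply: cvgMl_tmp; exact: cvg_id.
  exact: (continuous_subspaceT cc).
- move=> t; rewrite in_itv /= => t01.
  rewrite -(similarity_operatorE c d beta f k a_gt0 t01) (fG k) //.
  have /andP[t0 t1] := t01; have ak := a_gt0 k; rewrite breakpointS.
  by apply/andP; split; nra.
Qed.

(** * Values at the breakpoints, and necessity of D <= 1 *)

Hypothesis f0 : f 0 = 0.
Hypothesis f1 : f 1 = 1.
Hypothesis c0 : forall k, c k = 0.

Lemma self_similar_segment0 (k : 'I_n) :
  {in `[0, 1], forall t, f (a k * t + breakpoint a k) = d k * f t + beta k}.
Proof. by move=> t /self_similar_segment ->; rewrite c0 mul0r add0r. Qed.

Lemma self_similar_breakpoint (k : 'I_n) : f (breakpoint a k) = beta k.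
Proof.
have := @self_similar_segment0 k 0; rewrite f0 !mulr0 !add0r; apply.
by rewrite in_itv /= lexx ler01.
Qed.

Lemma self_similar_breakpointS (k : 'I_n) :
  f (breakpoint a k.+1) = d k + beta k.
Proof.
have := @self_similar_segment0 k 1; rewrite f1 !mulr1 addrC -breakpointS; apply.
by rewrite in_itv /= lexx ler01.
Qed.

(** Each [d k] is the increment of [f] over a cell, and these increments telescope to
    [f 1 - f 0]. *)
Lemma self_similar_sum_d : \sum_(k < n) d k = 1.
Proof.
transitivity (f (breakpoint a n) - f (breakpoint a 0)); last first.
  by rewrite breakpoint_size a_sum breakpoint0 f0 f1 subr0.
rewrite -(telescope_sumr (fun k => f (breakpoint a k)) (leq0n n)) big_mkord.
apply: eq_bigr => k _.
by rewrite self_similar_breakpointS self_similar_breakpoint addrK.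
Qed.

(** Here [breakpoint] applied to the [|d k|] serves as their partial sum. Total variation is
    additive over adjacent cells, and each cell contributes at least [|d k|] times the whole. *)
Lemma self_similar_total_variation_ge (m : nat) : (m <= n)%N ->
  bounded_variation 0 1 f ->
  ((breakpoint (fun k => `|d k|) m * fine (total_variation 0 1 f))%:E <=
   total_variation 0 (breakpoint a m) f)%E.
Proof.
move=> mn /(bounded_variationP _ ler01) fV.
elim: m mn => [_|m IH mn]; first by rewrite !breakpoint0 mul0r total_variationxx.
have := breakpointS a (Ordinal mn).
have := breakpointS (fun k => `|d k|) (Ordinal mn).
move=> /= -> am; have := breakpoint_itv m; rewrite in_itv /= => /andP[m0 _].
have mS : breakpoint a m <= breakpoint a m.+1 by exact: breakpoint_le.
rewrite (total_variationD _ m0 mS) mulrDl EFinD leeD ?IH 1?ltnW //.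
rewrite EFinM fineK // am addrC.
have := total_variation_affine_ge (a_gt0 _) ler01
  (self_similar_segment0 (Ordinal mn)).
by rewrite mulr0 add0r mulr1.
Qed.

Lemma bounded_variation_sum_le1 :
  bounded_variation 0 1 f -> \sum_(k < n) `|d k| <= 1.
Proof.
move=> fbv; have fV := (bounded_variationP _ ler01).1 fbv.
have V1 : 1 <= fine (total_variation 0 1 f).
  rewrite -lee_fin fineK //; have := total_variation_ge f (@ler01 R).
  by rewrite f0 f1 subr0 normr1.
have := self_similar_total_variation_ge (leqnn n) fbv.
rewrite !breakpoint_size a_sum -[leRHS]fineK // lee_fin.
by rewrite ger_pMl // (lt_le_trans ltr01).
Qed.

(** * Sufficiency of D <= 1, through monotonicity *)

Hypothesis d_sum : \sum_(k < n) `|d k| <= 1.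

(** The nonnegative terms [|d i| - d i] have sum at most [1 - 1], so all of them vanish. *)
Lemma self_similar_d_ge0 (k : 'I_n) : 0 <= d k.
Proof.
have ge0 (i : 'I_n) : true -> 0 <= `|d i| - d i by rewrite subr_ge0 ler_norm.
have /(psumr_eq0P ge0) : \sum_(i < n) (`|d i| - d i) = 0.
  apply/eqP; rewrite eq_le sumr_ge0 // andbT sumrB self_similar_sum_d.
  by rewrite subr_le0.
by move=> /(_ k isT) /subr0_eq <-.
Qed.

Lemma self_similar_d_lt1 (k : 'I_n) : d k < 1.
Proof.
have [dmax _ _] := fss; apply: le_lt_trans dmax.
by apply: le_trans (ler_norm _) _; apply: le_bigmax_cond.
Qed.

Lemma self_similar_breakpoint_le (i j : nat) : (i <= j <= n)%N ->
  f (breakpoint a i) <= f (breakpoint a j).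
Proof.
elim: j => [|j IH]; first by rewrite leqn0 => /andP[/eqP ->].
rewrite leq_eqVlt ltnS => /andP[/predU1P[-> //|ij] jn].
apply: le_trans (IH _) _; first by rewrite ij ltnW.
have := self_similar_breakpoint (Ordinal jn).
have := self_similar_breakpointS (Ordinal jn) => /= -> ->.
by rewrite lerDr self_similar_d_ge0.
Qed.

Lemma beta_itv (k : 'I_n) : 0 <= beta k /\ d k + beta k <= 1.
Proof.
rewrite -self_similar_breakpointS -self_similar_breakpoint; split.
  by rewrite -f0 -(breakpoint0 a) self_similar_breakpoint_le //= ltnW.
by rewrite -f1 -a_sum -breakpoint_size self_similar_breakpoint_le // ltn_ord /=.
Qed.

Lemma self_similar_size_gt0 : (0 < n)%N.
Proof.
rewrite lt0n; apply/eqP => n0; move: a_sum.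
rewrite big1 => [/eqP|[i /= i_n] _]; first by rewrite eq_sym oner_eq0.
by exfalso; rewrite n0 in i_n.
Qed.

Lemma self_similar_cell (x : R) : x \in `[0, 1] ->
  exists k, exists2 t, t \in `[0, 1] & x = a k * t + breakpoint a k.
Proof.
move=> x01; apply: breakpoint_cell => //; first exact: self_similar_size_gt0.
by move: x01; rewrite in_itv /= a_sum.
Qed.

(** At a minimum point [y] in cell [k], [f y = d k * f t + beta k >= d k * f y], so
    [(1 - d k) * f y >= 0]. At a maximum point, [beta k <= 1 - d k] gives the upper bound in the
    same way. *)
Lemma self_similar_itv (x : R) : x \in `[0, 1] -> 0 <= f x <= 1.
Proof.
move=> x01; have [_ cf _] := fss; apply/andP; split.
  have [y y01 fy] := EVT_min ler01 cf; apply: le_trans (fy _ x01).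
  have [k [t t01 yE]] := self_similar_cell y01.
  have [b0 _] := beta_itv k; have := self_similar_d_lt1 k.
  have := self_similar_d_ge0 k; have := fy _ t01.
  have := self_similar_segment0 k t01; rewrite -yE; nra.
have [y y01 fy] := EVT_max ler01 cf; apply: le_trans (fy _ x01) _.
have [k [t t01 yE]] := self_similar_cell y01.
have [_ b1] := beta_itv k; have := self_similar_d_lt1 k.
have := self_similar_d_ge0 k; have := fy _ t01.
have := self_similar_segment0 k t01; rewrite -yE; nra.
Qed.

Let drops := [set r | exists s t : R,
  [/\ s \in `[0, 1], t \in `[0, 1], s <= t & r = f s - f t]].

Let drops_has_sup : has_sup drops.
Proof.
split; first by exists 0, 0, 0; rewrite !in_itv /= lexx ler01 subrr.
exists 1 => r [s [t [/self_similar_itv/andP[_ s1]]]].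
by move=> /self_similar_itv/andP[t0 _] _ ->; lra.
Qed.

Lemma self_similar_nondecreasing :
  {in `[0, 1] &, {homo f : x y / x <= y}}.
Proof.
have sup_ub r : drops r -> r <= sup drops by exact: sup_upper_bound.
have sup_ge0 : 0 <= sup drops.
  by apply: sup_ub; exists 0, 0; rewrite !in_itv /= lexx ler01 subrr.
set dmax := \big[Num.max/0]_(k < n) `|d k|.
have dmax_lt1 : dmax < 1 by have [] := fss.
have dmax_ge k : d k <= dmax.
  by apply: le_trans (ler_norm _) _; apply: le_bigmax_cond.
(* With [0 <= sup drops] and [dmax < 1], this bound forces the supremum to be 0. *)
suff contraction : ubound drops (dmax * sup drops).
  have sup_le : sup drops <= dmax * sup drops.
    by apply: ge_sup => //; case: drops_has_sup.
  have sup0 : sup drops = 0 by nra.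
  move=> s t s01 t01 st; rewrite -subr_le0 -sup0.
  by apply: sup_ub; exists s, t.
move=> r [s [t [s01 t01 st ->]]].
have [i [u u01 sE]] := self_similar_cell s01.
have dmax_ge0 : 0 <= dmax.
  by apply: le_trans (dmax_ge i); exact: self_similar_d_ge0.
have [j [v v01 tE]] := self_similar_cell t01.
have /andP[u0 u1] : 0 <= u <= 1 by move: u01; rewrite in_itv.
have /andP[v0 v1] : 0 <= v <= 1 by move: v01; rewrite in_itv.
have ai := a_gt0 i; have aj := a_gt0 j.
case: (ltngtP i j) => [ij|ji|/val_inj ij].
(* No drop between distinct cells: as [f] takes values in [[0, 1]], [f s] is at most the value at
   the right end of cell [i], which is at most the value at the left end of cell [j], hence at most
   [f t]. *)
- apply: le_trans (mulr_ge0 dmax_ge0 sup_ge0); rewrite subr_le0.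
  have := self_similar_breakpoint_le (introT andP (conj ij (ltnW (ltn_ord j)))).
  rewrite self_similar_breakpointS self_similar_breakpoint sE tE.
  rewrite !self_similar_segment0 //.
  have /andP[_ fu] := self_similar_itv u01.
  have /andP[fv _] := self_similar_itv v01.
  have := self_similar_d_ge0 i; have := self_similar_d_ge0 j; nra.
(* Cell [j] lies to the left of cell [i], so [s <= t] is possible only at a shared breakpoint. *)
- suff -> : s = t by rewrite subrr mulr_ge0.
  apply/le_anti; rewrite st /=.
  have := breakpoint_le a_gt0 ji; rewrite breakpointS sE tE; nra.
(* Within one cell the drop is [d i] times the drop from [u] to [v], and rescaling keeps the
   order. *)
- subst j; rewrite sE tE !self_similar_segment0 //.
  have uv : u <= v by move: st; rewrite sE tE lerD2r ler_pM2l.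
  have : f u - f v <= sup drops by apply: sup_ub; exists u, v.
  have := dmax_ge i; have := self_similar_d_ge0 i; nra.
Qed.

End self_similar.

Theorem mainTheorem9 (R : realType) (n : nat) (a c d beta : 'I_n -> R)
    (f : R -> R) :
  (1 < n)%N ->
  (forall k, 0 < a k) ->
  \sum_(k < n) a k = 1 ->
  continuous_self_similar a c d beta f ->
  f 0 = 0 ->
  f 1 = 1 ->
  (forall k, c k = 0) ->
  bounded_variation 0 1 f <-> \sum_(k < n) `|d k| <= 1.
Proof.
move=> _ a0 a1 fss f0 f1 c0; split.
  exact: bounded_variation_sum_le1 a0 a1 fss f0 f1 c0.
move=> d1; apply: nondecreasing_bounded_variation.
exact: self_similar_nondecreasing a0 a1 fss f0 f1 c0 d1.
Qed.
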